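(* Let $N\geq 1$, let $\mu>0$, and let $\boldsymbol{L}\in\mathbb{R}^{N\times N}$ be invertible. Let $T:\mathbb{R}\to\mathbb{R}$ be a firmly nonexpansive function with $\operatorname{dom}T=\mathbb{R}$. Then there exists a proper lower-semicontinuous convex function $\Phi:\mathbb{R}\to(-\infty,+\infty]$ such that, for every input $\boldsymbol{y}\in\mathbb{R}^N$, the reconstruction sequence $\{\boldsymbol{x}^{(k)}\}$ of the generalized ADMM associated with the separable operator $T$ (with any initialization $\boldsymbol{u}^{(0)},\boldsymbol{\alpha}^{(0)}\in\mathbb{R}^N$) converges, as $k\to\infty$, to $$\boldsymbol{x}^{*}=\operatorname{argmin}_{\boldsymbol{x}\in\mathbb{R}^N}\left\{\frac12\|\boldsymbol{y}-\boldsymbol{x}\|_2^2+\sum_{i=1}^{N}\Phi([\boldsymbol{L}\boldsymbol{x}]_i)\right\}.$$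
   Context: A function $T:\mathbb{R}\to\mathbb{R}$ is firmly nonexpansive if $(x-y)(T(x)-T(y))\geq (T(x)-T(y))^2$ for all $x,y$ in its domain. The separable operator associated with $T$, also denoted $T$, acts on $\boldsymbol{u}\in\mathbb{R}^N$ by $T(\boldsymbol{u})=(T(u_1),\ldots,T(u_N))$. Given $\boldsymbol{y}\in\mathbb{R}^N$, a matrix $\boldsymbol{L}\in\mathbb{R}^{N\times N}$, a penalty parameter $\mu>0$ and initial vectors $\boldsymbol{u}^{(0)},\boldsymbol{\alpha}^{(0)}\in\mathbb{R}^N$, the generalized ADMM associated with $T$ is the iteration, for $k=0,1,2,\ldots$, $$\boldsymbol{x}^{(k+1)}=\left(\boldsymbol{I}+\mu\boldsymbol{L}^{\mathsf T}\boldsymbol{L}\right)^{-1}\left(\boldsymbol{y}+\boldsymbol{L}^{\mathsf T}\left(\mu\boldsymbol{u}^{(k)}+\boldsymbol{\alpha}^{(k)}\right)\right),$$ $$\boldsymbol{\alpha}^{(k+1)}=\boldsymbol{\alpha}^{(k)}-\mu\left(\boldsymbol{L}\boldsymbol{x}^{(k+1)}-\boldsymbol{u}^{(k)}\right),$$ $$\boldsymbol{u}^{(k+1)}=T\left(\boldsymbol{L}\boldsymbol{x}^{(k+1)}-\tfrac1\mu\boldsymbol{\alpha}^{(k+1)}\right),$$ where $\boldsymbol{I}$ is the $N\times N$ identity matrix. $[\boldsymbol{L}\boldsymbol{x}]_i$ denotes the $i$-th entry of $\boldsymbol{L}\boldsymbol{x}$. *)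

(* Defs.v *)
From HB Require Import structures.
From mathcomp Require Import all_boot all_order all_algebra.
From mathcomp Require Import all_classical all_reals all_analysis.

Set Implicit Arguments.
Unset Strict Implicit.
Unset Printing Implicit Defensive.

Import Order.TTheory GRing.Theory Num.Theory.
Import numFieldNormedType.Exports.

Local Open Scope classical_set_scope.
Local Open Scope ring_scope.

Definition firmly_nonexpansive (R : realType) (T : R -> R) : Prop :=
  forall x y : R, (x - y) * (T x - T y) >= (T x - T y) ^+ 2.

Definition separable_op (R : realType) (T : R -> R) (N : nat) (u : 'cV[R]_N) :
  'cV[R]_N := map_mx T u.

(* The library's norm on 'cV[R]_N is the sup norm, hence this definition. *)
Definition norm2 (R : realType) (N : nat) (v : 'cV[R]_N) : R :=
  Num.sqrt (\sum_(i < N) v i ord0 ^+ 2).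

(* Values in (-oo, +oo], not identically +oo. *)
Definition proper_function (R : realType) (Phi : R -> \bar R) : Prop :=
  (forall x, Phi x <> -oo%E) /\ (exists x, Phi x <> +oo%E).

(* The library's [convex_function] only covers real-valued functions.
   Restricting to 0 < t < 1 loses nothing and avoids products 0 * +oo. *)
Definition econvex_function (R : realType) (Phi : R -> \bar R) : Prop :=
  forall x y t : R, 0 < t -> t < 1 ->
    (Phi (t * x + (1 - t) * y)%R <= t%:E * Phi x + (1 - t)%:E * Phi y)%E.

Definition argmin (R : realType) (X : Type) (F : X -> \bar R) : set X :=
  [set x | forall z, (F x <= F z)%E].

Definition objective (R : realType) (N : nat) (L : 'M[R]_N) (Phi : R -> \bar R)
    (y x : 'cV[R]_N) : \bar R :=
  ((2^-1 * norm2 (y - x) ^+ 2)%:E + \sum_(i < N) Phi ((L *m x) i ord0))%E.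

(* The sequences x, u, alpha are generated by the iteration; u 0 and alpha 0
   are the initial vectors, and x 0 is a dummy that is never used. For mu > 0
   the matrix I + mu L^T L is positive definite, so invmx is its inverse. *)
Definition generalized_ADMM (R : realType) (N : nat) (T : R -> R) (mu : R)
    (L : 'M[R]_N) (y : 'cV[R]_N) (x u alpha : nat -> 'cV[R]_N) : Prop :=
  forall k : nat,
    [/\ x k.+1 = invmx (1%:M + mu *: (L^T *m L))
                   *m (y + L^T *m (mu *: u k + alpha k)),
        alpha k.+1 = alpha k - mu *: (L *m x k.+1 - u k)
      & u k.+1 = separable_op T (L *m x k.+1 - mu^-1 *: alpha k.+1)].

(* Main.v *)
(* In the variable sigma = u + alpha / mu the ADMM is the Douglas-Rachford map
   sigma |-> (sigma + (2 T - I) r) / 2, where r is the reflection of sigma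
   through the resolvent of the quadratic term.  That term is strongly convex
   and smooth because L is invertible, so sigma |-> r is a strict Euclidean
   contraction; 2 T - I is nonexpansive; hence the whole map is a strict
   contraction, which gives a fixed point and convergence from any start.

   On the line T has an antiderivative F, and firm nonexpansiveness upgrades
   convexity of F to F z >= F w + (z - w) T w + (T z - T w)^2 / 2.  This is
   exactly what makes the supremum over z of the affine functions
   mu (z T z - F z - (T z)^2 / 2 + (z - T z) (u - T z)) finite at u = T w,
   attained at z = w: it is a function Phi with mu (w - T w) in the
   subdifferential of Phi at T w.  At the fixed point these subgradients
   cancel the gradient of the quadratic term. *)
Require Import Defs.
From HB Require Import structures.
From mathcomp Require Import all_boot all_order all_algebra.
From mathcomp Require Import ring lra.
From mathcomp Require Import all_classical all_reals all_analysis.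

Set Implicit Arguments.
Unset Strict Implicit.
Unset Printing Implicit Defensive.

Import Order.TTheory GRing.Theory Num.Theory.
Import numFieldNormedType.Exports.

Local Open Scope classical_set_scope.
Local Open Scope ring_scope.

(** * Euclidean inner product and positive definiteness *)

Definition dot (R : realType) (N : nat) (v w : 'cV[R]_N) : R :=
  (v^T *m w) ord0 ord0.

Section Dot.
Context {R : realType} {N : nat}.
Implicit Types (v w : 'cV[R]_N) (A : 'M[R]_N).

Lemma dotE v w : dot v w = \sum_i v i ord0 * w i ord0.
Proof. by rewrite /dot mxE; apply: eq_bigr => i _; rewrite mxE. Qed.

Lemma dotC v w : dot v w = dot w v.
Proof. by rewrite !dotE; apply: eq_bigr => i _; rewrite mulrC. Qed.

Lemma dotDl v1 v2 w : dot (v1 + v2) w = dot v1 w + dot v2 w.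
Proof. by rewrite /dot linearD mulmxDl mxE. Qed.

Lemma dotZl a v w : dot (a *: v) w = a * dot v w.
Proof. by rewrite /dot linearZ -scalemxAl mxE. Qed.

Lemma dotNl v w : dot (- v) w = - dot v w.
Proof. by rewrite -scaleN1r dotZl mulN1r. Qed.

Lemma dotDr v w1 w2 : dot v (w1 + w2) = dot v w1 + dot v w2.
Proof. by rewrite !(dotC v) dotDl. Qed.

Lemma dotZr a v w : dot v (a *: w) = a * dot v w.
Proof. by rewrite !(dotC v) dotZl. Qed.

Lemma dotNr v w : dot v (- w) = - dot v w.
Proof. by rewrite !(dotC v) dotNl. Qed.

Lemma dot_mulmxl A v w : dot (A *m v) w = dot v (A^T *m w).
Proof. by rewrite /dot trmx_mul mulmxA. Qed.

Lemma dot_sqE v : dot v v = \sum_i v i ord0 ^+ 2.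
Proof. by rewrite dotE; apply: eq_bigr => i _; rewrite expr2. Qed.

Lemma dot_ge0 v : 0 <= dot v v.
Proof. by rewrite dot_sqE; apply: sumr_ge0 => i _; exact: sqr_ge0. Qed.

Lemma coord_sqr_le_dot v i : v i ord0 ^+ 2 <= dot v v.
Proof.
rewrite dot_sqE (bigD1 i) //= lerDl; apply: sumr_ge0 => j _; exact: sqr_ge0.
Qed.

Lemma dot_le0_eq0 v : dot v v <= 0 -> v = 0.
Proof.
move=> v0; apply/matrixP => i j; rewrite ord1 mxE; apply/eqP.
by rewrite -sqrf_eq0 eq_le sqr_ge0 andbT (le_trans (coord_sqr_le_dot v i)).
Qed.

Lemma norm2_sqr v : norm2 v ^+ 2 = dot v v.
Proof. by rewrite /norm2 -dot_sqE sqr_sqrtr ?dot_ge0. Qed.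

(** Every |w_j| is at most the Euclidean norm of [w], so row i of [A *m w] is at most its l1 norm
    times |w|; [C] sums the squared l1 norms of the rows. *)
Lemma mulmx_dot_bound A :
  exists2 C : R, 0 <= C & forall w, dot (A *m w) (A *m w) <= C * dot w w.
Proof.
exists (\sum_i (\sum_j `|A i j|) ^+ 2).
  by apply: sumr_ge0 => i _; exact: sqr_ge0.
move=> w; rewrite dot_sqE mulr_suml; apply: ler_sum => i _.
rewrite -[X in _ * X]sqr_sqrtr ?dot_ge0// -exprMn.
rewrite -[X in X <= _]real_normK ?num_real//.
rewrite lerXn2r ?nnegrE ?mulr_ge0 ?sqrtr_ge0 ?sumr_ge0// mxE.
apply: le_trans (ler_norm_sum _ _ _) _.
rewrite mulr_suml; apply: ler_sum => j _; rewrite normrM ler_wpM2l//.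
by rewrite -sqrtr_sqr ler_wsqrtr// coord_sqr_le_dot.
Qed.

(** Pairing the matrix with a kernel vector v gives |v|^2 = - mu |L v|^2, which forces v = 0. *)
Lemma regularized_gram_unit (L : 'M[R]_N) (mu : R) : 0 < mu ->
  1%:M + mu *: (L^T *m L) \in unitmx.
Proof.
move=> mu0; rewrite -unitmx_tr -row_free_unit; apply: inj_row_free => v.
move=> /(congr1 trmx); rewrite trmx_mul trmxK trmx0 mulmxDl mul1mx.
rewrite -scalemxAl -mulmxA => e; apply: (can_inj trmxK); rewrite trmx0.
apply: dot_le0_eq0; have /(congr1 (dot v^T)) := e.
rewrite dotDr dotZr -[in dot v^T (L^T *m _)]dot_mulmxl dotC => e'.
have -> : dot v^T v^T = - (mu * dot (L *m v^T) (L *m v^T)).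
  apply/eqP; rewrite -addr_eq0; apply/eqP.
  by rewrite e' dotC -[0](scale0r 0) dotZl mul0r.
by rewrite oppr_le0 mulr_ge0 ?dot_ge0 ?ltW.
Qed.

End Dot.

(** * Antiderivative of a firmly nonexpansive function *)

Section FirmlyNonexpansive.
Context {R : realType} {T : R -> R} (hT : firmly_nonexpansive T).

Lemma firmly_nonexpansive_le x y : x <= y -> 0 <= T y - T x <= y - x.
Proof.
rewrite le_eqVlt => /predU1P[->|xy]; first by rewrite !subrr lexx.
have := hT y x; set d := T y - T x => h.
have d0 : 0 <= d.
  by rewrite -(pmulr_rge0 _ (_ : 0 < y - x)) ?subr_gt0// (le_trans (sqr_ge0 d)).
rewrite d0/=; move: d0; rewrite le_eqVlt => /predU1P[<-|d0].
  by rewrite subr_ge0 ltW.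
by rewrite -(ler_pM2r d0) -expr2.
Qed.

Lemma firmly_nonexpansive_continuous : continuous T.
Proof.
move=> x; apply/cvgrPdist_lt => e e0; near=> y.
apply: (@le_lt_trans _ _ `|x - y|); last first.
  by near: y; apply: cvgr_dist_lt => //; exact: cvg_id.
have [xy|/ltW xy] := leP x y.
- have /andP[h1 h2] := firmly_nonexpansive_le xy.
  by rewrite distrC (distrC x) ger0_norm// ger0_norm// subr_ge0.
- have /andP[h1 h2] := firmly_nonexpansive_le xy.
  by rewrite ger0_norm// ger0_norm// subr_ge0.
Unshelve. all: by end_near. Qed.

Let mu := @lebesgue_measure R.

Let T_integrable (a b : R) : mu.-integrable `[a, b] (EFin \o T).
Proof.
apply: continuous_compact_integrable; first exact: segment_compact.
by apply: continuous_subspaceT => x; exact: firmly_nonexpansive_continuous.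
Qed.

Let T_integral_split (a b c : R) : a <= b -> b <= c ->
  \int[mu]_(t in `[a, c]) T t =
  \int[mu]_(t in `[a, b]) T t + \int[mu]_(t in `[b, c]) T t.
Proof.
move=> ab bc.
rewrite -(@Rintegral_itv_obnd_cbnd _ b); last first.
  apply: integrableS (T_integrable b c) => //.
  by apply: subset_itvr; rewrite bnd_simp.
rewrite -(@Rintegral_itvB _ T (BLeft a) (BRight c) b)// -/mu.
by rewrite [RHS]addrC subrK.
Qed.

Lemma firmly_nonexpansive_antiderivative :
  exists F : R -> R, forall a b : R, a <= b ->
    (b - a) * T a <= F b - F a <= (b - a) * T b.
Proof.
(* At least one of the two integrals vanishes, so this is the oriented integral of [T] from 0 to
   [x]. *)
exists (fun x => \int[mu]_(t in `[0, x]) T t - \int[mu]_(t in `[x, 0]) T t).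
move=> a b ab.
have self (x y : R) : y <= x -> \int[mu]_(t in `[x, y]) T t = 0.
  rewrite le_eqVlt => /predU1P[->|yx]; first by rewrite set_itv1 Rintegral_set1.
  by rewrite set_itv_ge ?Rintegral_set0// bnd_simp -ltNge.
have integral_ab_cst r : \int[mu]_(t in `[a, b]) r = (b - a) * r.
  have mu_ab : mu `[a, b]%classic = (b - a)%:E.
    apply: etrans (lebesgue_measure_itv `[a, b]) _; rewrite /= lte_fin.
    move: ab; rewrite le_eqVlt => /predU1P[->|->]; last by [].
    by rewrite ltxx subrr.
  rewrite Rintegral_cst// mulrC; congr (_ * _); exact: (congr1 fine mu_ab).
have cst_integrable r : mu.-integrable `[a, b] (EFin \o cst r).
  apply: continuous_compact_integrable; first exact: segment_compact.
  by apply: continuous_subspaceT => x; exact: cst_continuous.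
suff -> : \int[mu]_(t in `[0, b]) T t - \int[mu]_(t in `[b, 0]) T t -
    (\int[mu]_(t in `[0, a]) T t - \int[mu]_(t in `[a, 0]) T t) =
    \int[mu]_(t in `[a, b]) T t.
  rewrite -!integral_ab_cst; apply/andP; split.
  - apply: (le_Rintegral _ (cst_integrable _) (T_integrable a b)) => // x /=.
    rewrite in_itv/= => /andP[ax xb].
    by have /andP[+ _] := firmly_nonexpansive_le ax; rewrite subr_ge0.
  - apply: (le_Rintegral _ (T_integrable a b) (cst_integrable _)) => // x /=.
    rewrite in_itv/= => /andP[ax xb].
    by have /andP[+ _] := firmly_nonexpansive_le xb; rewrite subr_ge0.
have [a0|/ltW a0] := leP 0 a.
  rewrite (self b 0) ?(le_trans a0)// (self a 0)//.
  by rewrite (T_integral_split a0 ab); ring.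
have [b0|/ltW b0] := leP 0 b.
  by rewrite (self b 0)// (self 0 a)// (T_integral_split a0 b0); ring.
by rewrite (self 0 a)// (self 0 b)// (T_integral_split ab b0); ring.
Qed.

(** A Baillon-Haddad type inequality: [F] is convex with 1-Lipschitz derivative [T]. It is reached
    by bisection, without differentiating [F]. *)
Lemma firmly_nonexpansive_cocoercive :
  exists F : R -> R, forall w z : R,
    F w + (z - w) * T w + (T z - T w) ^+ 2 / 2 <= F z.
Proof.
have [F hF] := firmly_nonexpansive_antiderivative; exists F.
(* Halving the interval halves the error term, starting from the bracket
   given by the monotonicity of T. *)
have bisect (n : nat) (a b : R) : a <= b ->
    (b - a) * T a + (T b - T a) ^+ 2 / 2 - (b - a) ^+ 2 / 2 * 2^-1 ^+ n
      <= F b - F a /\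
    F b - F a <=
      (b - a) * T b - (T b - T a) ^+ 2 / 2 + (b - a) ^+ 2 / 2 * 2^-1 ^+ n.
  elim: n a b => [|n IH] a b ab.
    have /andP[h1 h2] := hF _ _ ab; rewrite expr0.
    have /andP[h3 h4] := firmly_nonexpansive_le ab.
    have : (T b - T a) ^+ 2 <= (b - a) ^+ 2.
      by rewrite lerXn2r// nnegrE// subr_ge0.
    split.
      lra.
    lra.
  pose c := (a + b) / 2.
  have ac : a <= c by rewrite /c; lra.
  have cb : c <= b by rewrite /c; lra.
  have [h1 h2] := IH _ _ ac; have [h3 h4] := IH _ _ cb.
  have /andP[h5 h6] := firmly_nonexpansive_le ac.
  have /andP[h7 h8] := firmly_nonexpansive_le cb.
  (* Adding the bounds on the two halves leaves exactly [m1] as slack in the lower bound and [m2] in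
     the upper one; two errors of a quarter the size add up to half the error. *)
  have m1 : 0 <= (T c - T a) * ((b - c) - (T b - T c)).
    by rewrite mulr_ge0// subr_ge0.
  have m2 : 0 <= (T b - T c) * ((c - a) - (T c - T a)).
    by rewrite mulr_ge0// subr_ge0.
  rewrite (exprS _ n); set e := 2^-1 ^+ n in h1 h2 h3 h4 *.
  have ca2 : c - a = (b - a) / 2 by rewrite /c; field.
  have bc2 : b - c = (b - a) / 2 by rewrite /c; field.
  rewrite ?ca2 ?bc2 in h1 h2 h3 h4 m1 m2.
  by split; lra.
have half : @GRing.exp R 2^-1 n @[n --> \oo] --> 0.
  by apply: cvg_expr; rewrite ger0_norm ?invf_lt1 ?ltr1n.
have lim (x C : R) : (forall n, x <= C * 2^-1 ^+ n) -> x <= 0.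
  move=> h; have : C * 2^-1 ^+ n @[n --> \oo] --> C * 0 by exact: cvgMr.
  rewrite mulr0 => hc.
  rewrite -(cvg_lim _ hc)//; apply: limr_ge; first by apply/cvg_ex; exists 0.
  exact: nearW.
move=> w z; rewrite -subr_le0; have [wz|/ltW zw] := leP w z.
- apply: (lim _ ((z - w) ^+ 2 / 2)) => n; have [h _] := bisect n _ _ wz; lra.
- apply: (lim _ ((w - z) ^+ 2 / 2)) => n; have [_ h] := bisect n _ _ zw.
  by rewrite -(sqrrN (T z - T w)) opprB; lra.
Qed.

End FirmlyNonexpansive.

(** * Suprema of affine functions and the penalty [Phi] *)

Section AffineSup.
Context {R : realType} (p c : R -> R).

Definition affine_sup (u : R) : \bar R :=
  ereal_sup (range (fun z => (p z * u + c z)%:E)).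

Lemma affine_sup_ub z u : ((p z * u + c z)%:E <= affine_sup u)%E.
Proof. by apply: ereal_sup_ubound; exists z. Qed.

Lemma affine_sup_gtNy u : affine_sup u <> -oo%E.
Proof. by move=> h; have := affine_sup_ub 0 u; rewrite h. Qed.

Lemma affine_sup_lsc : lower_semicontinuous affine_sup.
Proof.
move=> x a /ereal_sup_gt[_ [z _ <-]]; rewrite lte_fin => ax.
exists [set y | a < p z * y + c z]; last first.
  by move=> y /= ay; apply: lt_le_trans (affine_sup_ub z y); rewrite lte_fin.
have cz : (p z * y + c z) @[y --> x] --> p z * x + c z.
  by apply: cvgD; [apply: cvgMr; exact: cvg_id|exact: cvg_cst].
exact: (cvgr_gt _ cz).
Qed.

Lemma affine_sup_convex : econvex_function affine_sup.
Proof.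
move=> x y t t0 t1; apply: ge_ereal_sup => _ [z _ <-].
have -> : p z * (t * x + (1 - t) * y) + c z =
    t * (p z * x + c z) + (1 - t) * (p z * y + c z) by ring.
rewrite EFinD !EFinM; apply: leeD.
- by apply: lee_wpmul2l; [rewrite lee_fin ltW|exact: affine_sup_ub].
- by apply: lee_wpmul2l; [rewrite lee_fin subr_ge0 ltW|exact: affine_sup_ub].
Qed.

End AffineSup.

(** The last clause encodes that [T] is the proximity operator of Phi / mu: mu (z - T z) is a
    subgradient of [Phi] at [T z], where [Phi] is finite. *)
Lemma firmly_nonexpansive_prox (R : realType) (T : R -> R) (mu : R) :
  0 < mu -> firmly_nonexpansive T ->
  exists Phi : R -> \bar R,
    [/\ proper_function Phi, lower_semicontinuous Phi, econvex_function Phi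
      & forall z, exists r : R, Phi (T z) = r%:E /\
          forall u, ((r + mu * (z - T z) * (u - T z))%:E <= Phi u)%E].
Proof.
move=> mu0 hT; have [F hF] := firmly_nonexpansive_cocoercive hT.
(* With F* the convex conjugate of [F], z T z - F z is F* at [T z]; thus [r z] is mu (F* - |.|^2 /
   2) at [T z]. The intercept [c z] makes the affine function of slope [p z] take the value [r z] at
   [T z]. *)
pose r z := mu * (z * T z - F z - T z ^+ 2 / 2).
pose p z := mu * (z - T z); pose c z := r z - p z * T z.
have eqr z : affine_sup p c (T z) = (r z)%:E.
  apply/le_anti/andP; split; last first.
    by have := affine_sup_ub p c z (T z); rewrite /c addrC subrK.
  apply: ge_ereal_sup => _ [w _ <-]; rewrite lee_fin /c /r /p.
  (* The affine function of index [w] stays below [r z] at [T z] by exactly mu times the slack of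
     the inequality [hF z w]. *)
  have := ler_wpM2l (ltW mu0) (hF z w); nra.
exists (affine_sup p c); split.
- by split; [exact: affine_sup_gtNy|exists (T 0); rewrite eqr].
- exact: affine_sup_lsc.
- exact: affine_sup_convex.
- move=> z; exists (r z); split => // u.
  by apply: le_trans (affine_sup_ub p c z u); rewrite lee_fin /c /p; lra.
Qed.

(** * Contractions for the Euclidean distance *)

Section DotConvergence.
Context {R : realType} {N : nat}.
Implicit Types (v p : 'cV[R]_N) (s : nat -> 'cV[R]_N).

(** This links Euclidean estimates to the topology of column vectors: the sup norm is attained at
    one coordinate. *)
Lemma norm_sqr_le_dot v : `|v| ^+ 2 <= dot v v.
Proof.
have [->|] := eqVneq `|v| 0; first by rewrite expr0n/= dot_ge0.
move=> /mx_norm_neq0[[i j]]; rewrite /= ord1 => h.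
by rewrite /Num.norm/= h real_normK ?num_real// coord_sqr_le_dot.
Qed.

Lemma dot_cvg s p :
  dot (s k - p) (s k - p) @[k --> \oo] --> 0 -> s k @[k --> \oo] --> p.
Proof.
move=> h; apply/cvgrPdist_lt => e e0.
have small := cvgr_lt _ h _ (exprn_gt0 2 e0); near=> k.
have hk : dot (s k - p) (s k - p) < e ^+ 2 by near: k; exact: small.
rewrite distrC -(ltr_pXn2r (_ : 0 < 2)%N) ?nnegrE ?(ltW e0)//.
exact: le_lt_trans (norm_sqr_le_dot _) hk.
Unshelve. all: by end_near. Qed.

(** The telescoping series of the increments converges absolutely by comparison with a geometric
    series. *)
Lemma geometric_increments_cvg (a : nat -> R) (C q : R) :
  0 <= q -> q < 1 -> (forall k, `|a k.+1 - a k| <= C * q ^+ k) -> cvgn a.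
Proof.
move=> q0 q1 h.
have Cq : cvgn (series (geometric C q)).
  by apply: is_cvg_geometric_series; rewrite ger0_norm.
have : cvgn (series (telescope a)).
  apply: normed_cvg; apply: series_le_cvg Cq => //.
  - by move=> n; exact: normr_ge0.
  - by move=> n; exact: le_trans (normr_ge0 _) (h n).
rewrite telescopeK => /(is_cvgD (is_cvg_cst (a 0%N))).
suff -> : (fun=> a 0%N) + [sequence a n - a 0%N]_n = a by [].
by apply/funext => n /=; rewrite fctE addrC subrK.
Qed.

Lemma dot_addr_le u v : dot (u + v) (u + v) <= 2 * dot u u + 2 * dot v v.
Proof.
have := dot_ge0 (u - v).
rewrite !(dotDl, dotDr, dotNl, dotNr) (dotC v u); lra.
Qed.

Variables (f : 'cV[R]_N -> 'cV[R]_N) (q : R).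
Hypotheses (q0 : 0 <= q) (q1 : q < 1).
Hypothesis fq : forall u v,
  dot (f u - f v) (f u - f v) <= q * dot (u - v) (u - v).

Lemma dot_contraction_orbit s p : (forall k, s k.+1 = f (s k)) -> f p = p ->
  dot (s k - p) (s k - p) @[k --> \oo] --> 0.
Proof.
move=> hs fp.
have h k : dot (s k - p) (s k - p) <= dot (s 0%N - p) (s 0%N - p) * q ^+ k.
  elim: k => [|k IH]; first by rewrite expr0 mulr1.
  rewrite hs -[X in _ - X]fp exprS mulrCA; apply: le_trans (fq _ _) _.
  by rewrite ler_wpM2l.
apply: (@squeeze_cvgr _ _ _ _ (fun=> 0)
  (fun k => dot (s 0%N - p) (s 0%N - p) * q ^+ k)).
- by apply: nearW => k; rewrite dot_ge0 h.
- exact: cvg_cst.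
- rewrite -(mulr0 (dot (s 0%N - p) (s 0%N - p))); apply: cvgMr.
  by apply: cvg_expr; rewrite ger0_norm.
Qed.

Lemma dot_contraction_fixpoint : exists p, f p = p.
Proof.
pose s k := iter k f 0; pose D := dot (s 1%N - s 0%N) (s 1%N - s 0%N).
have step k : dot (s k.+1 - s k) (s k.+1 - s k) <= D * q ^+ k.
  elim: k => [|k IH]; first by rewrite expr0 mulr1.
  rewrite exprS mulrCA; apply: le_trans (fq _ _) _.
  by rewrite ler_wpM2l.
have coord_cvg i : cvgn (fun k => s k i ord0).
  (* [q] and [D] concern squared distances, hence the square roots for increments of a
     coordinate. *)
  apply: (@geometric_increments_cvg _ (Num.sqrt D) (Num.sqrt q)).
  - exact: sqrtr_ge0.
  - by rewrite -sqrtr1 ltr_sqrt.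
  - move=> k; have rhs_ge0 : 0 <= Num.sqrt D * Num.sqrt q ^+ k.
      by rewrite mulr_ge0 ?exprn_ge0 ?sqrtr_ge0.
    rewrite -(ler_pXn2r (_ : 0 < 2)%N) ?nnegrE//.
    rewrite exprMn exprAC !sqr_sqrtr// ?dot_ge0// real_normK ?num_real//.
    apply: le_trans (step k).
    by have := coord_sqr_le_dot (s k.+1 - s k) i; rewrite !mxE.
pose p : 'cV[R]_N := \col_i lim (s k i ord0 @[k --> \oo]).
have sp : dot (s k - p) (s k - p) @[k --> \oo] --> 0.
  have -> : (fun k => dot (s k - p) (s k - p)) =
      (fun k => \sum_i (s k i ord0 - p i ord0) ^+ 2).
    apply/funext => k; rewrite dot_sqE.
    by apply: eq_bigr => i _; rewrite !mxE.
  have sum0 : \sum_(i < N) (0 : R) = 0 by rewrite big1.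
  rewrite -[X in _ --> X]sum0; apply: cvg_big => [|i _].
    exact: add_continuous.
  have h : (s k i ord0 - p i ord0) @[k --> \oo] --> 0.
    rewrite -(subrr (p i ord0)); apply: cvgB; last exact: cvg_cst.
    by rewrite mxE; exact: coord_cvg.
  by rewrite -(mulr0 0); exact: cvgM.
exists p; apply/eqP; rewrite -subr_eq0; apply/eqP/dot_le0_eq0.
(* This sequence tends to 0 and bounds |f p - p|^2 for every k, by inserting f (s k) = s (k+1)
   between f p and p. *)
have h : 2 * (q * dot (s k - p) (s k - p)) +
    2 * dot (s k.+1 - p) (s k.+1 - p) @[k --> \oo] --> 2 * (q * 0) + 2 * 0.
  apply: cvgD; first by apply: cvgMr; exact: cvgMr.
  by apply: cvgMr; rewrite (cvg_shiftS (fun k => dot (s k - p) (s k - p))).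
rewrite !mulr0 addr0 in h; rewrite -(cvg_lim _ h)//.
apply: limr_ge; first by apply/cvg_ex; exists 0.
apply: nearW => k.
have -> : f p - p = (f p - f (s k)) + (s k.+1 - p) by rewrite addrA subrK.
apply: le_trans (dot_addr_le _ _) _; rewrite lerD2r ler_wpM2l//.
apply: le_trans (fq _ _) _.
by rewrite -opprB dotNl dotNr opprK.
Qed.

End DotConvergence.

(** * The ADMM as a Douglas-Rachford contraction *)

Section DouglasRachford.
Context {R : realType} {N : nat}.
Variables (T : R -> R) (mu : R) (L : 'M[R]_N) (y : 'cV[R]_N).
Implicit Types (s d r t w : 'cV[R]_N).

Let A := 1%:M + mu *: (L^T *m L).

(** The minimizer over x of |y - x|^2 / 2 + mu |L x - s|^2 / 2. *)
Definition x_of s : 'cV[R]_N := invmx A *m (y + mu *: (L^T *m s)).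

Definition reflected s : 'cV[R]_N := 2 *: (L *m x_of s) - s.

(** The second summand is half of [s - reflected s], which gives the averaged form (s + (2 T - I) r)
    / 2 with r = [reflected s]. *)
Definition douglas_rachford s : 'cV[R]_N :=
  separable_op T (reflected s) + (s - L *m x_of s).

Lemma generalized_ADMM_douglas_rachford (x u alpha : nat -> 'cV[R]_N) k :
  mu != 0 -> generalized_ADMM T mu L y x u alpha ->
  x k.+1 = x_of (u k + mu^-1 *: alpha k) /\
  u k.+1 + mu^-1 *: alpha k.+1 = douglas_rachford (u k + mu^-1 *: alpha k).
Proof.
move=> mu0 /(_ k)[hx ha hu]; set s := u k + _.
have mus : mu *: s = mu *: u k + alpha k.
  by rewrite scalerDr scalerA mulfV// scale1r.
have xE : x k.+1 = x_of s by rewrite hx -mus -scalemxAr.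
have aE : mu^-1 *: alpha k.+1 = s - L *m x_of s.
  rewrite ha xE scalerBr scalerA mulVf// scale1r opprB addrA.
  by rewrite [_ + u k]addrC.
split=> //; rewrite /douglas_rachford -aE; congr (_ + _).
rewrite hu aE xE /reflected.
by congr separable_op; rewrite opprB addrA scaler_nat mulr2n.
Qed.

Lemma x_of_sub s s' :
  x_of s - x_of s' = mu *: (invmx A *m (L^T *m (s - s'))).
Proof.
rewrite /x_of -mulmxBr opprD addrACA subrr add0r -scalerBr -mulmxBr.
by rewrite -scalemxAr.
Qed.

Hypotheses (mu0 : 0 < mu) (hT : firmly_nonexpansive T).

Lemma separable_op_firm r r' :
  let t := separable_op T r - separable_op T r' in dot t t <= dot t (r - r').
Proof.
rewrite /= !dotE; apply: ler_sum => i _; rewrite !mxE -expr2 mulrC.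
exact: hT.
Qed.

(* The left-hand side is |((2 t - r) + d) / 2|^2. *)
Lemma firm_average_le t r d : dot t t <= dot t r ->
  dot (t + 2^-1 *: (d - r)) (t + 2^-1 *: (d - r)) <= (dot d d + dot r r) / 2.
Proof.
move=> h; have := dot_ge0 (2 *: t - r - d).
rewrite !(dotDl, dotDr, dotNl, dotNr, dotZl, dotZr).
rewrite (dotC r t) (dotC d t) (dotC d r); lra.
Qed.

(** Since A w = L^T d, the product of L w and d is |w|^2 + mu |L w|^2; in the expansion of |2 mu L w
    - d|^2 the terms in |L w|^2 then cancel. *)
Lemma reflected_sub_dot s s' (d := s - s')
    (w := invmx A *m (L^T *m d)) (r := reflected s - reflected s') :
  dot r r = dot d d - 4 * mu * dot w w.
Proof.
have Aw : L^T *m d = w + mu *: (L^T *m (L *m w)).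
  rewrite -[LHS](mulKVmx (regularized_gram_unit L mu0)) -/A -/w.
  by rewrite mulmxDl mul1mx -scalemxAl mulmxA.
have -> : r = (2 * mu) *: (L *m w) - d.
  rewrite /r /reflected opprD addrACA -scalerBr -mulmxBr x_of_sub -/d -/w.
  by rewrite -scalemxAr scalerA -opprD.
have Lwd : dot (L *m w) d = dot w w + mu * dot (L *m w) (L *m w).
  by rewrite dot_mulmxl Aw dotDr dotZr -dot_mulmxl.
clearbody w d r.
rewrite !(dotDl, dotDr, dotNl, dotNr, dotZl, dotZr) (dotC d) Lwd.
ring.
Qed.

Hypothesis hL : L \in unitmx.

Lemma douglas_rachford_contraction : exists q : R, [/\ 0 <= q, q < 1 &
  forall s s', let d := douglas_rachford s - douglas_rachford s' in
    dot d d <= q * dot (s - s') (s - s')].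
Proof.
have [C C0 hC] := mulmx_dot_bound (invmx L^T *m A).
have Cmu : 0 < C + 2 * mu by rewrite ltr_wpDl// mulr_gt0.
(* Averaging gives the bound |d|^2 - 2 mu |w|^2, with |d|^2 <= C |w|^2 by invertibility of [L].
   Enlarging [C] by 2 mu keeps 1 - 2 mu / (C + 2 mu) well defined and nonnegative even if C is 0 or
   small. *)
exists (C / (C + 2 * mu)); split.
- by rewrite divr_ge0// ltW.
- by rewrite ltr_pdivrMr// mul1r ltrDl mulr_gt0.
move=> s s' /=; set d := s - s'; set w := invmx A *m (L^T *m d).
have dw : dot d d <= C * dot w w.
  have -> : d = invmx L^T *m A *m w; last exact: hC.
  rewrite -mulmxA /w mulKVmx ?regularized_gram_unit//.
  by rewrite mulKmx// unitmx_tr.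
set t := separable_op T (reflected s) - separable_op T (reflected s').
set r := reflected s - reflected s'.
have rr : dot r r = dot d d - 4 * mu * dot w w by exact: reflected_sub_dot.
have -> : douglas_rachford s - douglas_rachford s' = t + 2^-1 *: (d - r).
  rewrite /douglas_rachford /t opprD addrACA; congr (_ + _).
  rewrite /d /r /reflected; set v := L *m _; set v' := L *m _.
  by apply/matrixP => i j; rewrite !mxE; field.
have := firm_average_le d (separable_op_firm (reflected s) (reflected s')).
move=> /le_trans; apply; rewrite -/r rr.
rewrite [leRHS]mulrAC ler_pdivlMr//.
have h1 : 0 <= mu * (C * dot w w - dot d d) by rewrite pmulr_rge0// subr_ge0.
have h2 : 0 <= mu * (mu * dot w w) by rewrite !pmulr_rge0// dot_ge0.
clear -h1 h2; lra.
Qed.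

Lemma douglas_rachford_fixpoint_optimal (Phi : R -> \bar R) p :
  (forall z, exists r : R, Phi (T z) = r%:E /\
     forall u, ((r + mu * (z - T z) * (u - T z))%:E <= Phi u)%E) ->
  douglas_rachford p = p -> argmin (objective L Phi y) = [set x_of p].
Proof.
move=> hPhi fp; set x := x_of p; set v := L *m x.
have Tv i : T (reflected p i ord0) = v i ord0.
  have /matrixP/(_ i ord0) := fp; rewrite !mxE -/x -/v; lra.
(* The limiting multiplier: L^T alpha is the gradient of the quadratic term at [x], and each -
   alpha_i is a subgradient of [Phi] at v_i, because [reflected p] is 2 v - p. *)
pose alpha := mu *: (p - v).
have grad : x - y = L^T *m alpha.
  have : A *m x = y + mu *: (L^T *m p).
    by rewrite mulKVmx// regularized_gram_unit.
  rewrite mulmxDl mul1mx -scalemxAl -mulmxA -/v => h.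
  rewrite /alpha -scalemxAr mulmxBr scalerBr.
  apply: (addIr (mu *: (L^T *m v))); rewrite subrK addrAC h.
  by rewrite addrAC subrr add0r.
have /choice[c hc] : forall i, exists r : R, Phi (v i ord0) = r%:E /\
    forall u, ((r - alpha i ord0 * (u - v i ord0))%:E <= Phi u)%E.
  move=> i; have [r [e hr]] := hPhi (reflected p i ord0).
  exists r; rewrite -Tv; split => // u; apply: le_trans (hr u).
  by rewrite lee_fin Tv /alpha /reflected !mxE -/x -/v; lra.
have obj_x : objective L Phi y x =
    (2^-1 * dot (y - x) (y - x) + \sum_i c i)%:E.
  rewrite /objective norm2_sqr EFinD -sumEFin; congr (_ + _)%E.
  by apply: eq_bigr => i _; rewrite (hc i).1.
(* Quadratic growth from the strong convexity of the data term; it yields both optimality and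
   uniqueness of [x]. *)
have growth x' : ((2^-1 * dot (y - x) (y - x) + \sum_i c i +
    2^-1 * dot (x' - x) (x' - x))%:E <= objective L Phi y x')%E.
  apply: (@le_trans _ _ (2^-1 * dot (y - x') (y - x') +
     \sum_i (c i - alpha i ord0 * ((L *m x') i ord0 - v i ord0)))%:E);
    last first.
    rewrite /objective norm2_sqr EFinD -sumEFin leeD2l//.
    by apply: lee_sum => i _; exact: (hc i).2.
  rewrite lee_fin sumrB.
  have -> : \sum_i alpha i ord0 * ((L *m x') i ord0 - v i ord0) =
      dot (x - y) (x' - x).
    rewrite grad dot_mulmxl trmxK mulmxBr dotE.
    by apply: eq_bigr => i _; rewrite !mxE.
  have -> : y - x' = (y - x) - (x' - x) by rewrite opprB addrA subrK.
  have -> : x - y = - (y - x) by rewrite opprB.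
  rewrite !(dotDl, dotDr, dotNl, dotNr) !(dotC x' _) (dotC x y); lra.
apply/seteqP; split=> [x' /= hx'|_ -> x' /=]; last first.
  apply: le_trans (growth x'); rewrite obj_x lee_fin lerDl.
  by rewrite mulr_ge0 ?dot_ge0// invr_ge0.
apply/eqP; rewrite -subr_eq0; apply/eqP/dot_le0_eq0.
have := le_trans (growth x') (hx' x).
by rewrite obj_x lee_fin gerDl pmulr_rle0// invr_gt0.
Qed.

End DouglasRachford.

Theorem theorem5 (R : realType) (N : nat) (hN : (1 <= N)%N) (mu : R)
    (hmu : 0 < mu) (L : 'M[R]_N) (hL : L \in unitmx) (T : R -> R)
    (hT : firmly_nonexpansive T) :
  exists Phi : R -> \bar R,
    [/\ proper_function Phi, lower_semicontinuous Phi, econvex_function Phi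
      & forall y : 'cV[R]_N,
          exists xstar : 'cV[R]_N,
            argmin (objective L Phi y) = [set xstar] /\
            forall x u alpha : nat -> 'cV[R]_N,
              generalized_ADMM T mu L y x u alpha ->
              x k @[k --> \oo] --> xstar].
Proof.
have [Phi [proper_Phi lsc_Phi convex_Phi prox_Phi]] :=
  firmly_nonexpansive_prox hmu hT.
exists Phi; split=> // y.
have [q [q0 q1 hq]] := douglas_rachford_contraction y hmu hT hL.
have [p fp] := dot_contraction_fixpoint q0 q1 hq.
exists (x_of mu L y p); split.
  exact: (douglas_rachford_fixpoint_optimal hmu prox_Phi fp).
move=> x u alpha hADMM.
have step k := generalized_ADMM_douglas_rachford k (lt0r_neq0 hmu) hADMM.
pose s k := u k + mu^-1 *: alpha k.
have sp : dot (s k - p) (s k - p) @[k --> \oo] --> 0.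
  by apply: (dot_contraction_orbit q0 q1 hq) => // k; have [] := step k.
(* The iteration does not constrain [x 0]; the shifted sequence is the image of [s] under the
   affine, hence Lipschitz, map [x_of]. *)
rewrite -cvg_shiftS; apply: dot_cvg.
have [C C0 hC] :=
  mulmx_dot_bound (mu *: (invmx (1%:M + mu *: (L^T *m L)) *m L^T)).
apply: (@squeeze_cvgr _ _ _ _ (fun=> 0) (fun k => C * dot (s k - p) (s k - p))).
- apply: nearW => k; rewrite dot_ge0/=; have [-> _] := step k.
  by rewrite x_of_sub mulmxA [mu *: (_ *m (_ - p))]scalemxAl; exact: hC.
- exact: cvg_cst.
- by rewrite -(mulr0 C); exact: cvgMr.
Qed.
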